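(* Let $N\ge 1$ be an integer, let $\alpha<1$ be real, and for $c>0$ let $a_n=a_n(c)$ and $b_n=b_n(c)$ be the recurrence coefficients of the orthonormal polynomials for the weight $w(x)=\binom{N}{x}\frac{c^x}{(1-\alpha)_x}$, $x\in\{0,1,\ldots,N\}$. Put $$x_n(c)=\frac1N\left(\frac{a_n(c)^2}{c}+n\right),\qquad y_n(c)=-\frac{b_n(c)+N+1+c-n-\alpha}{N}.$$ Then, for each $n$, there is a solution $y=y(c)$ of the fifth Painlevé equation $$y''=\left(\frac{1}{2y}+\frac{1}{y-1}\right)(y')^2-\frac{y'}{c}+\frac{(y-1)^2}{c^2}\left(Ay+\frac{B}{y}\right)+\frac{Cy}{c}+\frac{Dy(y+1)}{y-1},\qquad {}'=\frac{d}{dc},$$ with parameters $$A=\frac{(\alpha-N-1)^2}{2},\qquad B=-\frac{(n-N)^2}{2},\qquad C=-(n+\alpha),\qquad D=-\frac12,$$ such that $$x_n(c)=\frac{(cy'+n-N)^2-2(n-N)(n-N+cy')\,y-A_1y^4+A_2y^3-A_3y^2}{4cN(y-1)y^2},$$ $$y_n(c)=\frac{N-n+y\bigl(1+n+c-\alpha+(\alpha-N-1)y\bigr)-cy'}{2N(y-1)y},$$ where $$A_1=(1+N-\alpha)^2,\quad A_2=2(1+N-\alpha)(1+c+N-\alpha),\quad A_3=(1+c+n-\alpha)(1+c-n+2N-\alpha).$$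
   Context: The Pochhammer symbol is $(a)_n=\prod_{j=0}^{n-1}(a+j)$, with $(a)_0=1$. Orthonormal polynomials for the weight $w$ on $\{0,1,\ldots,N\}$: real polynomials $p_0,\ldots,p_N$ (depending on $c$ and $\alpha$) with $\deg p_n=n$ and positive leading coefficient such that $\sum_{k=0}^N p_m(k)p_n(k)w(k)=\delta_{m,n}$ for $0\le m,n\le N$. The recurrence coefficients are $a_n=\sum_{k=0}^N k\,p_n(k)p_{n-1}(k)w(k)$ and $b_n=\sum_{k=0}^N k\,p_n(k)^2w(k)$, with $p_{-1}=0$ (so $a_0=0$), for $n=0,\ldots,N$. They appear in the three-term recurrence relation $xp_n(x)=a_{n+1}p_{n+1}(x)+b_np_n(x)+a_np_{n-1}(x)$. The index $n$ in the claim is any index for which these recurrence coefficients are defined.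
   Formalization: For n = N the two formulas force y = 0, where the quotients and the Painlevé equation are undefined, so the claim fails; for that index the equation and both formulas are stated with denominators multiplied out (solved by y = 0). For n < N the claim is as written. *)

(* Defs.v *)
From HB Require Import structures.
From mathcomp Require Import all_boot all_order all_algebra.
From mathcomp Require Import all_classical all_reals all_analysis.

Set Implicit Arguments.
Unset Strict Implicit.
Unset Printing Implicit Defensive.

Import Order.TTheory GRing.Theory Num.Theory.
Import numFieldNormedType.Exports.

Local Open Scope ring_scope.

Definition pochhammer (R : realType) (a : R) (n : nat) : R :=
  \prod_(j < n) (a + j%:R).

Definition krawtchouk_weight (R : realType) (N : nat) (alpha c : R) (x : nat)
  : R := 'C(N, x)%:R * (c ^+ x / pochhammer (1 - alpha) x).

Definition orthonormal_polys (R : realType) (N : nat) (w : nat -> R)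
    (p : nat -> {poly R}) : Prop :=
  (forall n, (n <= N)%N -> size (p n) = n.+1 /\ 0 < lead_coef (p n)) /\
  (forall m n, (m <= N)%N -> (n <= N)%N ->
     \sum_(k < N.+1) (p m).[k%:R] * (p n).[k%:R] * w k = (m == n)%:R).

(* p_{-1} = 0, hence a_0 = 0 *)
Definition rec_a (R : realType) (N : nat) (w : nat -> R)
    (p : nat -> {poly R}) (n : nat) : R :=
  if n is m.+1 then
    \sum_(k < N.+1) k%:R * (p n).[k%:R] * (p m).[k%:R] * w k
  else 0.

Definition rec_b (R : realType) (N : nat) (w : nat -> R)
    (p : nat -> {poly R}) (n : nat) : R :=
  \sum_(k < N.+1) k%:R * (p n).[k%:R] ^+ 2 * w k.

Definition xseq (R : realType) (N : nat) (alpha : R)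
    (p : R -> nat -> {poly R}) (n : nat) (c : R) : R :=
  1 / N%:R * (rec_a N (krawtchouk_weight N alpha c) (p c) n ^+ 2 / c + n%:R).

Definition yseq (R : realType) (N : nat) (alpha : R)
    (p : R -> nat -> {poly R}) (n : nat) (c : R) : R :=
  - ((rec_b N (krawtchouk_weight N alpha c) (p c) n
      + N%:R + 1 + c - n%:R - alpha) / N%:R).

Definition twice_derivable (R : realType) (y : R -> R) (c : R) : Prop :=
  derivable y c 1 /\ derivable (derive1 y) c 1.

Definition painleveV (R : realType) (A B C D : R) (y : R -> R) (c : R) : Prop :=
  derive1 (derive1 y) c =
    (1 / (2 * y c) + 1 / (y c - 1)) * derive1 y c ^+ 2
    - derive1 y c / c
    + (y c - 1) ^+ 2 / c ^+ 2 * (A * y c + B / y c)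
    + C * y c / c
    + D * y c * (y c + 1) / (y c - 1).

(* The previous equation multiplied by 2 c^2 y (y - 1); unlike the quotient
   form it also makes sense for y = 0, which it admits when B = 0. *)
Definition painleveV_cleared (R : realType) (A B C D : R) (y : R -> R) (c : R)
  : Prop :=
  2 * c ^+ 2 * y c * (y c - 1) * derive1 (derive1 y) c =
    c ^+ 2 * (3 * y c - 1) * derive1 y c ^+ 2
    - 2 * c * y c * (y c - 1) * derive1 y c
    + 2 * (y c - 1) ^+ 3 * (A * y c ^+ 2 + B)
    + 2 * c * C * y c ^+ 2 * (y c - 1)
    + 2 * c ^+ 2 * D * y c ^+ 2 * (y c + 1).

(* Numerators and denominators of the expressions of x_n(c) and y_n(c) in
   terms of v = y(c) and d = y'(c). *)
Definition xnum (R : realType) (N n : nat) (alpha c v d : R) : R :=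
  let A1 := (1 + N%:R - alpha) ^+ 2 in
  let A2 := 2 * (1 + N%:R - alpha) * (1 + c + N%:R - alpha) in
  let A3 := (1 + c + n%:R - alpha) * (1 + c - n%:R + 2 * N%:R - alpha) in
  (c * d + n%:R - N%:R) ^+ 2
  - 2 * (n%:R - N%:R) * (n%:R - N%:R + c * d) * v
  - A1 * v ^+ 4 + A2 * v ^+ 3 - A3 * v ^+ 2.

Definition xden (R : realType) (N : nat) (c v : R) : R :=
  4 * c * N%:R * (v - 1) * v ^+ 2.

Definition ynum (R : realType) (N n : nat) (alpha c v d : R) : R :=
  N%:R - n%:R
  + v * (1 + n%:R + c - alpha + (alpha - N%:R - 1) * v)
  - c * d.

Definition yden (R : realType) (N : nat) (v : R) : R :=
  2 * N%:R * (v - 1) * v.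

(* Main.v *)
Require Import Defs.
From HB Require Import structures.
From mathcomp Require Import all_boot all_order all_algebra.
From mathcomp Require Import all_classical all_reals all_analysis.
From mathcomp Require Import ring lra.

(* Let P_j be the monic orthogonal polynomials of the weight, beta_j = a_j^2,
   K = N + 1 - alpha, and let S_j = \sum_k P_j(k) w(k) / (k + 1 - alpha) be
   their Cauchy transforms at alpha - 1.  For n < N the solution is
     y = (u - v) / K,  u = P_{n+1}(N) / P_n(N),  v = S_{n+1} / S_n,
   which is smooth because P_n(N) and S_n never vanish, and satisfies
   0 < y < 1 because u > 0 > v and because N - b_n - u >= 0 > alpha - 1 - b_n - v.
   The Pearson equation of the weight gives
     c (N - x) P_n(x + 1) = (c (N - n) - beta_n - c x) P_n(x)
                            + (x + b_n + c - alpha - n + 1) beta_n P_{n-1}(x);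
   its value at x = N and its Cauchy transform at alpha - 1 express u, v and
   beta_n polynomially in b_n and y.  The weight satisfies c w' = x w, whence
   c P_j' = - beta_j P_{j-1} and c b_j' = beta_{j+1} - beta_j, so u and v solve
   Riccati equations.  Eliminating b_n, beta_n and beta_{n+1} from these
   relations yields the fifth Painleve equation and the formulas for x_n, y_n.
   The formula for y as a rational function of x_n and y_n degenerates to 0/0
   at the values of c where P_n(alpha) = 0; the quotients u and v do not. *)

Set Implicit Arguments.
Unset Strict Implicit.
Unset Printing Implicit Defensive.

Import Order.TTheory GRing.Theory Num.Theory.
Import numFieldNormedType.Exports.

Local Open Scope ring_scope.

(** * Orthogonality on the nodes 0, ..., N *)

(** Writing [q] as [r * 'X + d], the difference of [q] is ['X + a] times the difference of [r], plus
    [a *: r]; induction on the degree gives both claims. At [m = 0] the truncated index [m.-1] is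
    harmless, since both sides are 0. *)
Lemma size_shift_sub (R : comNzRingType) (a : R) (m : nat) (q : {poly R}) :
  (size q <= m.+1)%N ->
  (size (q \Po ('X + a%:P) - q)%R <= m)%N /\
  (q \Po ('X + a%:P) - q)`_m.-1 = a * m%:R * q`_m.
Proof.
elim: m q => [|m IHm] q sq.
  by rewrite (size1_polyC sq) comp_polyC subrr size_poly0 coef0 mulr0 mul0r.
elim/poly_ind: q sq => [|q d _] sq.
  by rewrite comp_poly0 subrr size_poly0 !coef0 mulr0.
have {}sq : (size q <= m.+1)%N.
  move: sq; rewrite -cons_poly_def size_cons_poly.
  by case: ifP => [/andP[/nilP -> _] // _|_]; rewrite ltnS.
have [sD cD] := IHm q sq.
have -> : (q * 'X + d%:P) \Po ('X + a%:P) - (q * 'X + d%:P) =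
    (q \Po ('X + a%:P) - q) * 'X + a *: (q \Po ('X + a%:P) - q) + a *: q.
  rewrite comp_polyD comp_polyM comp_polyX comp_polyC -!mul_polyC; ring.
set D := q \Po _ - q in sD cD *.
split.
  rewrite !(leq_trans (size_polyD _ _)) // !geq_max ?(leq_trans (size_scale_leq _ _)) //=.
  rewrite !(leq_trans (size_polyD _ _)) // !geq_max ?(leq_trans (size_scale_leq _ _)) //=.
    rewrite (leq_trans (size_polyMleq _ _)) // size_polyX addn2 /= ltnS //.
  exact: leqW.
rewrite /= !coefD !coefMX !coefZ coefC /= (nth_default _ sD) mulr0 !addr0.
case: m {IHm sq} sD cD => [|m] sD /= cD; first by rewrite mulr1 add0r.
by rewrite cD -[m.+2%:R]natr1; ring.
Qed.

Lemma size_leXM (R : nzRingType) (m : nat) (q : {poly R}) :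
  (size q <= m)%N -> (size ('X * q)%R <= m.+1)%N.
Proof.
by move=> sq; rewrite (leq_trans (size_polyMleq _ _)) // size_polyX add2n.
Qed.

Lemma size_leD (R : nzRingType) (m : nat) (p q : {poly R}) :
  (size p <= m)%N -> (size q <= m)%N -> (size (p + q)%R <= m)%N.
Proof. by move=> sp sq; rewrite (leq_trans (size_polyD _ _)) // geq_max sp. Qed.

Lemma size_leZ (R : nzRingType) (m : nat) (a : R) (q : {poly R}) :
  (size q <= m)%N -> (size (a *: q)%R <= m)%N.
Proof. exact: leq_trans (size_scale_leq _ _). Qed.

Definition node_sum (R : nzRingType) (N : nat) (w : nat -> R) (f : {poly R}) : R :=
  \sum_(k < N.+1) f.[k%:R] * w k.

Section NodeSum.
Variables (R : comNzRingType) (N : nat) (w : nat -> R).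
Local Notation L := (node_sum N w).

Lemma node_sumD f g : L (f + g) = L f + L g.
Proof. by rewrite -big_split; apply: eq_bigr => k _; rewrite hornerD mulrDl. Qed.

Lemma node_sumZ a f : L (a *: f) = a * L f.
Proof. by rewrite mulr_sumr; apply: eq_bigr => k _; rewrite hornerZ mulrA. Qed.

Lemma node_sumN f : L (- f) = - L f.
Proof. by rewrite -scaleN1r node_sumZ mulN1r. Qed.

Lemma node_sumB f g : L (f - g) = L f - L g.
Proof. by rewrite node_sumD node_sumN. Qed.

Lemma node_sumCM a f : L (a%:P * f) = a * L f.
Proof. by rewrite mul_polyC node_sumZ. Qed.

Lemma node_sum0 : L 0 = 0.
Proof. by rewrite -(scale0r 0) node_sumZ mul0r. Qed.

Lemma eq_node_sum f g (w' : nat -> R) :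
  (forall k, (k <= N)%N -> f.[k%:R] * w k = g.[k%:R] * w' k) ->
  L f = node_sum N w' g.
Proof. by move=> fg; apply: eq_bigr => k _; apply: fg; rewrite -ltnS. Qed.

End NodeSum.

Lemma poly_nodes_eq0 (R : numDomainType) (M : nat) (q : {poly R}) :
  (size q <= M)%N -> (forall k, (k < M)%N -> q.[k%:R] = 0) -> q = 0.
Proof.
move=> sq q0; apply: (@roots_geq_poly_eq0 _ _ [seq k%:R | k <- iota 0 M]).
- by apply/allP => _ /mapP[k + ->]; rewrite mem_iota /= => kM; apply/rootP/q0.
- by rewrite map_inj_uniq ?iota_uniq // => i j /eqP; rewrite eqr_nat => /eqP.
- by rewrite size_map size_iota.
Qed.

(** Strict positivity on the first [M] nodes already detects a polynomial of size at most [M]. This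
    admits the weight [(N - k) * w k], which vanishes at the last node. *)
Lemma node_sum_sqr_gt0 (R : realFieldType) (N M : nat) (w : nat -> R)
    (q : {poly R}) :
  (forall k, (k <= N)%N -> 0 <= w k) -> (forall k, (k < M)%N -> 0 < w k) ->
  (M <= N.+1)%N -> (size q <= M)%N -> q != 0 -> 0 < node_sum N w (q * q).
Proof.
move=> w_ge0 w_gt0 MN sq; rewrite ltNge; apply: contra => L_le0; apply/eqP.
apply: (poly_nodes_eq0 sq) => k kM.
have ge0 (i : 'I_N.+1) : true -> 0 <= (q * q).[i%:R] * w i.
  by move=> _; rewrite hornerM mulr_ge0 ?w_ge0 -?expr2 ?sqr_ge0 // -ltnS.
have L0 : node_sum N w (q * q) = 0.
  by apply/eqP; rewrite eq_le L_le0 /= sumr_ge0.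
have /(_ (Ordinal (leq_trans kM MN)) isT) := psumr_eq0P ge0 L0.
by move/eqP; rewrite hornerM -expr2 mulf_eq0 (gt_eqF (w_gt0 _ kM)) orbF sqrf_eq0 => /eqP.
Qed.

(** * Monic orthogonal polynomials and their three-term recurrence *)

Definition monic_orthogonal (R : nzRingType) (N : nat) (w : nat -> R)
    (P : nat -> {poly R}) : Prop :=
  (forall n, (n <= N)%N -> size (P n) = n.+1 /\ P n \is monic) /\
  (forall m n, (m <= N)%N -> (n <= N)%N -> m != n ->
     node_sum N w (P m * P n) = 0).

Definition sqnorm (R : nzRingType) N (w : nat -> R) (P : nat -> {poly R}) n :=
  node_sum N w (P n * P n).

Definition diag_coef (R : unitRingType) N (w : nat -> R) (P : nat -> {poly R}) n :=
  node_sum N w (P n * ('X * P n)) / sqnorm N w P n.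

(** This is [a_n ^ 2]. The value 0 at index 0 cancels every occurrence of [P n.-1] at [n = 0], where
    [n.-1] is again 0. *)
Definition sub_coef (R : unitRingType) N (w : nat -> R) (P : nat -> {poly R}) n :=
  if n is m.+1 then sqnorm N w P n / sqnorm N w P m else 0.

Section MonicOrthogonal.
Variables (R : realFieldType) (N : nat) (w : nat -> R) (P : nat -> {poly R}).
Implicit Types q r : {poly R}.
Hypothesis w_gt0 : forall k, (k <= N)%N -> 0 < w k.
Hypothesis P_orth : monic_orthogonal N w P.
Local Notation L := (node_sum N w).
Local Notation h := (sqnorm N w P).
Local Notation b := (diag_coef N w P).
Local Notation beta := (sub_coef N w P).

Let sizeP n : (n <= N)%N -> size (P n) = n.+1.
Proof. by move=> nN; have [/(_ n nN)[]] := P_orth. Qed.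

Let monP n : (n <= N)%N -> P n \is monic.
Proof. by move=> nN; have [/(_ n nN)[]] := P_orth. Qed.

Let leadP n : (n <= N)%N -> (P n)`_n = 1.
Proof. by move=> nN; have /monicP := monP nN; rewrite lead_coefE sizeP. Qed.

Let sizeXP n : (n <= N)%N -> size ('X * P n) = n.+2.
Proof.
by move=> nN; rewrite mulrC size_mulX ?sizeP // -size_poly_eq0 sizeP.
Qed.

Let swapX q r : q * ('X * r) = r * ('X * q).
Proof. by rewrite mulrCA [RHS]mulrCA [q * r]mulrC. Qed.

Lemma size_sub_lead n q : (n <= N)%N -> (size q <= n.+1)%N ->
  (size (q - q`_n *: P n)%R <= n)%N.
Proof.
move=> nN sq; apply/leq_sizeP => j nj; rewrite coefB coefZ.
move: nj; rewrite leq_eqVlt => /predU1P[<-|nj]; first by rewrite leadP // mulr1 subrr.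
by rewrite [q`_j]nth_default ?[(P n)`_j]nth_default ?mulr0 ?subrr ?sizeP // (leq_trans sq).
Qed.

Lemma node_sum_span m q r : (m <= N.+1)%N ->
  (forall j, (j < m)%N -> L (q * P j) = 0) -> (size r <= m)%N -> L (q * r) = 0.
Proof.
elim: m r => [|m IHm] r mN q0 sr.
  by move: sr; rewrite leqn0 size_poly_eq0 => /eqP ->; rewrite mulr0 node_sum0.
rewrite -[r](subrK (r`_m *: P m)) mulrDr node_sumD -scalerAr node_sumZ q0 //.
rewrite mulr0 addr0 IHm ?(ltnW mN) //; last exact: size_sub_lead.
by move=> j jm; apply: q0; rewrite ltnS ltnW.
Qed.

Lemma orth_lt_size n q : (n <= N)%N -> (size q <= n)%N -> L (P n * q) = 0.
Proof.
move=> nN; apply: node_sum_span; first exact: leqW.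
by move=> j jn; apply: P_orth.2; rewrite ?gtn_eqF // (leq_trans (ltnW jn)).
Qed.

Lemma orth_lead n q : (n <= N)%N -> (size q <= n.+1)%N ->
  L (P n * q) = q`_n * h n.
Proof.
move=> nN sq; rewrite -{1}[q](subrK (q`_n *: P n)) mulrDr node_sumD.
by rewrite -scalerAr node_sumZ orth_lt_size ?add0r //; apply: size_sub_lead.
Qed.

(** Such a [q] is orthogonal to itself. Polynomial identities are proved with this: bound the size
    of the difference of the two sides, then test it against each [P j]. *)
Lemma orth_eq0 m q : (m <= N)%N -> (size q <= m.+1)%N ->
  (forall j, (j <= m)%N -> L (q * P j) = 0) -> q = 0.
Proof.
move=> mN sq q0; apply/eqP; apply: contraT => qn0.
have := @node_sum_sqr_gt0 R N N.+1 w q (fun k kN => ltW (w_gt0 kN)).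
move/(_ (fun k kN => w_gt0 kN) (leqnn _) (leq_trans sq (mN : m.+1 <= N.+1)%N) qn0).
by rewrite (@node_sum_span m.+1) ?ltxx.
Qed.

Lemma sqnorm_gt0 n : (n <= N)%N -> 0 < h n.
Proof.
move=> nN; apply: (@node_sum_sqr_gt0 R N N.+1) => // [k /w_gt0/ltW//||].
  by rewrite sizeP.
by rewrite -size_poly_eq0 sizeP.
Qed.

Let h_neq0 n : (n <= N)%N -> h n != 0.
Proof. by move=> nN; rewrite gt_eqF ?sqnorm_gt0. Qed.

Lemma sub_coef_gt0 n : (n < N)%N -> 0 < beta n.+1.
Proof. by move=> nN; rewrite divr_gt0 ?sqnorm_gt0 // ltnW. Qed.

Lemma sub_coef_ge0 n : (n <= N)%N -> 0 <= beta n.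
Proof. by case: n => // n nN; rewrite ltW // sub_coef_gt0. Qed.

Lemma diag_coef_ge0 n : (n <= N)%N -> 0 <= b n.
Proof.
move=> nN; rewrite divr_ge0 ?(ltW (sqnorm_gt0 _)) // sumr_ge0 // => k _.
rewrite mulrCA hornerM hornerX hornerM -expr2.
have kN : (k <= N)%N by rewrite -ltnS.
exact: mulr_ge0 (mulr_ge0 (ler0n _ _) (sqr_ge0 _)) (ltW (w_gt0 kN)).
Qed.

Lemma diag_coefM n : (n <= N)%N -> b n * h n = L (P n * ('X * P n)).
Proof. by move=> nN; rewrite divfK ?h_neq0. Qed.

Lemma node_sumXPP n : (n < N)%N -> L (P n.+1 * ('X * P n)) = h n.+1.
Proof.
move=> nN; rewrite orth_lead ?sizeXP ?(ltnW nN) //.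
by rewrite coefXM leadP ?mul1r // ltnW.
Qed.

(** The leading terms cancel, so it suffices to test against [P j] with [j <= n]: [j = n] defines
    [b n], [j = n - 1] gives [beta n], and smaller [j] vanish by degree. *)
Lemma monic_recurrence n : (n < N)%N ->
  P n.+1 = ('X - (b n)%:P) * P n - beta n *: P n.-1.
Proof.
move=> nN; have nN' := ltnW nN.
have n1N : (n.-1 <= N)%N by rewrite (leq_trans (leq_pred _)).
apply/esym/eqP; rewrite -subr_eq0; apply/eqP.
apply: (@orth_eq0 n) => //.
  apply/leq_sizeP => j nj.
  rewrite mulrBl !coefB mul_polyC !coefZ.
  rewrite [(P n.-1)`_j]nth_default ?sizeP //; last by case: (n) nj => // ? /ltnW.
  rewrite [(P n)`_j]nth_default ?sizeP // !mulr0 !subr0.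
  move: nj; rewrite leq_eqVlt => /predU1P[<-|nj].
    by rewrite coefXM /= leadP // leadP // subrr.
  by rewrite [('X * _)`_j]nth_default ?[(P n.+1)`_j]nth_default ?sizeXP ?sizeP ?subrr.
move=> j jn; have jN := leq_trans jn nN'.
rewrite !mulrBl -!scalerAl mul_polyC -scalerAl !node_sumB !node_sumZ.
rewrite (P_orth.2 n.+1 j) ?gtn_eqF // subr0.
have [->{j jn jN}|j_neq_n] := eqVneq j n.
  rewrite mulrC -diag_coefM // subrr sub0r.
  case: (n) nN' n1N => [|m] mN m1N /=; first by rewrite mul0r oppr0.
  by rewrite P_orth.2 ?mulr0 ?oppr0 // ltn_eqF.
rewrite [L (P n * P j)]P_orth.2 // 1?eq_sym // mulr0 subr0.
have {}jn : (j < n)%N by rewrite ltn_neqAle j_neq_n.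
case: n jn nN nN' n1N {j_neq_n} => // n jn nN nN' n1N /=.
move: jn; rewrite ltnS leq_eqVlt => /predU1P[->|jn].
  by rewrite mulrAC mulrC node_sumXPP // divfK ?subrr // h_neq0.
rewrite -mulrA mulrCA orth_lt_size ?sizeXP //.
by rewrite P_orth.2 ?mulr0 ?subrr // gtn_eqF.
Qed.

(** The left side is what differentiating the Cauchy transform of [P n] produces, with
    [d = c^-1]. *)
Lemma monic_recurrenceZ n d : (n < N)%N ->
  - (d * beta n) *: P n.-1 + d *: ('X * P n) = d *: (b n *: P n + P n.+1).
Proof.
move=> nN; rewrite (monic_recurrence nN); move: (b n) (beta n) => b0 beta0.
by rewrite -!mul_polyC polyCN polyCM; ring.
Qed.

Lemma sub_coef_node_sum n : (n <= N)%N ->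
  beta n * L (P n.-1 * ('X * P n)) = beta n * h n.
Proof.
case: n => [|n] nN; first by rewrite !mul0r.
by rewrite swapX node_sumXPP.
Qed.

Lemma sub_coef_orth n : (n <= N)%N -> beta n * L (P n.-1 * P n) = 0.
Proof.
case: n => [|n] nN; first by rewrite mul0r.
by rewrite P_orth.2 ?mulr0 // ?ltn_eqF // ltnW.
Qed.

Lemma node_sum_sqrX n : (n < N)%N ->
  L ('X * P n * ('X * P n)) = (beta n.+1 + b n ^+ 2 + beta n) * h n.
Proof.
move=> nN; have nN' := ltnW nN.
have -> : 'X * P n * ('X * P n) = P n.+1 * ('X * P n) +
    b n *: (P n * ('X * P n)) + beta n *: (P n.-1 * ('X * P n)).
  by rewrite (monic_recurrence nN) -!mul_polyC; ring.
rewrite !node_sumD !node_sumZ sub_coef_node_sum //.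
have <- : beta n.+1 * h n = L (P n.+1 * ('X * P n)).
  by rewrite node_sumXPP // divfK ?h_neq0.
by rewrite -diag_coefM //; ring.
Qed.

(** * Consequences of the Pearson equation of the weight *)

Section StructureRelation.
Variables alpha c : R.
Hypothesis alpha_lt1 : alpha < 1.
Hypothesis w_ratio : forall k, (k < N)%N ->
  k.+1%:R * (k.+1%:R - alpha) * w k.+1 = c * (N%:R - k%:R) * w k.
Let w' k := w k / (k%:R + 1 - alpha).
Local Notation L' := (node_sum N w').

Let den_gt0 k : 0 < k%:R + 1 - alpha.
Proof. by rewrite -addrA ltr_wpDl ?ler0n // subr_gt0. Qed.

Let w'_gt0 k : (k <= N)%N -> 0 < w' k.
Proof. by move=> kN; rewrite divr_gt0 ?w_gt0. Qed.

Lemma node_sum_cauchyM q : L' (q * ('X - (alpha - 1)%:P)) = L q.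
Proof.
apply: eq_node_sum => k kN; rewrite hornerM hornerXsubC /w' -mulrA; congr (_ * _).
by have /gt_eqF k0 := den_gt0 k; field; rewrite k0.
Qed.

(** Summation by shifting the index: ['X] kills the term at 0, [N - 'X] kills the term at [N], and
    [w_ratio] matches the others. *)
Lemma cauchy_pearson q :
  L ('X * q) = c * L' ((N%:R%:P - 'X) * (q \Po ('X + 1%:P))).
Proof.
rewrite /node_sum big_ord_recl big_ord_recr /= !(hornerM, hornerD, hornerN, hornerC, hornerX).
rewrite subrr !mul0r addr0 add0r mulr_sumr; apply: eq_bigr => k _.
have /gt_eqF k0 := den_gt0 k.
rewrite !(horner_comp, hornerM, hornerD, hornerN, hornerC, hornerX).
have -> : k%:R + 1 = k.+1%:R :> R by rewrite natr1.
rewrite /w' -[c * _](_ : (c * (N%:R - k%:R) * w k) / (k%:R + 1 - alpha) * q.[k.+1%:R] = _).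
  rewrite -w_ratio // -natr1; field; by rewrite k0.
by rewrite -natr1; field; rewrite k0.
Qed.

(** In [cauchy_pearson] for [('X - alpha%:P) * q], the shifted factor is ['X + 1 - alpha], which
    cancels the denominator of [w']. *)
Lemma pearson q :
  L ('X * (('X - alpha%:P) * q)) = c * L ((N%:R%:P - 'X) * (q \Po ('X + 1%:P))).
Proof.
rewrite cauchy_pearson -[L _]node_sum_cauchyM; congr (_ * L' _).
rewrite comp_polyM comp_polyB comp_polyX comp_polyC polyCB; ring.
Qed.

(** The difference of the two sides is tested against [P j] for [j <= n]. For [j = n] leading
    coefficients decide; for [j < n] the Pearson equation moves the shift from [P n] onto [P j],
    after which degrees leave few terms. *)
Lemma structure_relation n : (n < N)%N ->
  c *: ((N%:R%:P - 'X) * (P n \Po ('X + 1%:P))) =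
  ((c * (N%:R - n%:R) - beta n)%:P - c *: 'X) * P n +
  ('X + (b n + c - alpha - n%:R + 1)%:P) * (beta n *: P n.-1).
Proof.
move=> nN; have nN' := ltnW nN.
have sPn : (size (P n) <= n.+1)%N by rewrite sizeP.
have [sD cD] := size_shift_sub 1 sPn; rewrite leadP // mul1r mulr1 in cD.
set D := P n \Po _ - P n in sD cD.
have DE : P n \Po ('X + 1%:P) = P n + D by rewrite [RHS]addrC subrK.
clearbody D; rewrite DE.
have sB : (size (beta n *: P n.-1)%R <= n)%N.
  case: (n) nN' => [|m] mN; first by rewrite scale0r size_poly0.
  by rewrite size_leZ // sizeP // ltnW.
set B := _ *: P n.-1 in sB *.
have BE : B = beta n *: P n.-1 by [].
clearbody B; set t := b n + c - alpha - n%:R + 1.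
apply/eqP; rewrite -subr_eq0; apply/eqP.
set q := _ - _.
(* The two multiples of ['X * P n] cancel, whence the size of [q] is at most [n.+1]. *)
have qE : q = (c * n%:R + beta n) *: P n + (c * N%:R) *: D + (- c) *: ('X * D)
    + (-1) *: ('X * B) + (- t) *: B.
  rewrite /q -!mul_polyC; ring.
apply: (@orth_eq0 n) => //.
  by rewrite qE !size_leD ?size_leZ ?size_leXM // leqW.
move=> j; rewrite leq_eqVlt => /predU1P[->|jn].
  rewrite mulrC qE !mulrDr -!scalerAr !node_sumD !node_sumZ.
  rewrite [L (P n * D)]orth_lt_size // [L (P n * B)]orth_lt_size //.
  rewrite !orth_lead ?size_leXM ?leqnn // !coefXM.
  have -> : (if n == 0 then 0 else D`_n.-1) = n%:R by case: (n) cD.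
  have -> : (if n == 0 then 0 else B`_n.-1) = beta n.
    rewrite BE; case: (n) nN' => //= m mN; rewrite coefZ leadP ?mulr1 //.
    exact: ltnW.
  rewrite leadP //; ring.
have jN : (j <= N)%N := leq_trans (ltnW jn) nN'.
have sPj : (size (P j) <= j.+1)%N by rewrite sizeP.
(* The backward shift [P j + D'] is chosen because shifting it forward restores [P j]. *)
have [sD' cD'] := size_shift_sub (- 1) sPj; rewrite leadP // mulr1 mulN1r in cD'.
set D' := P j \Po _ - P j in sD' cD'.
have P'E : P j \Po ('X + (-1)%:P) = P j + D' by rewrite [RHS]addrC subrK.
clearbody D'.
have shK : (P j + D') \Po ('X + 1%:P) = P j.
  rewrite -P'E -comp_polyA comp_polyD comp_polyX comp_polyC.
  by rewrite polyCN addrK comp_polyXr.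
have := pearson (P n * (P j + D')); rewrite comp_polyM shK DE => pearsonE.
have -> : L (q * P j) = L (P n * ('X * ('X * P j))) + L (P n * ('X * ('X * D')))
    + (c - alpha) * L (P n * ('X * P j)) - alpha * L (P n * ('X * D'))
    - L (B * ('X * P j)) - t * L (B * P j).
  have -> : q * P j = c *: ((N%:R%:P - 'X) * ((P n + D) * P j))
      - (c * (N%:R - n%:R) - beta n) *: (P n * P j) + c *: (P n * ('X * P j))
      - B * ('X * P j) - t *: (B * P j).
    by rewrite /q -!mul_polyC; ring.
  rewrite !node_sumB node_sumD node_sumB !node_sumZ -pearsonE.
  rewrite (P_orth.2 n j) ?gtn_eqF // mulr0 subr0.
  have -> : 'X * (('X - alpha%:P) * (P n * (P j + D'))) =
      P n * ('X * ('X * P j)) + P n * ('X * ('X * D'))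
      - alpha *: (P n * ('X * P j)) - alpha *: (P n * ('X * D')).
    by rewrite -!mul_polyC; ring.
  rewrite !node_sumB node_sumD !node_sumZ; ring.
have sXD' : (size ('X * D')%R <= j.+1)%N by rewrite size_leXM.
rewrite [L (P n * ('X * D'))]orth_lt_size ?(leq_trans sXD') // mulr0 subr0.
have [m nE] : exists m, n = m.+1 by case: (n) jn => // m _; exists m.
subst n; have m_le_N := ltnW nN'.
have betaM : beta m.+1 * h m = h m.+1 by rewrite divfK ?h_neq0.
rewrite BE -!scalerAl !node_sumZ [m.+1.-1]/=; move: jn; rewrite ltnS leq_eqVlt.
case/predU1P => [jm|jm]; last first.
  (* For [j < m] only two terms survive, and they cancel through [beta m.+1 * h m = h m.+1]. *)
  have sXPj : (size ('X * P j)%R <= m.+1)%N by rewrite size_leXM ?sizeP.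
  rewrite [L (P m.+1 * ('X * ('X * D')))]orth_lt_size ?size_leXM ?(leq_trans sXD') //.
  rewrite [L (P m.+1 * ('X * P j))]orth_lt_size //.
  rewrite [L (P m * P j)]orth_lt_size ?sizeP //.
  rewrite (orth_lead nN' (size_leXM sXPj)) (orth_lead m_le_N sXPj) -betaM.
  by rewrite [in X in X * _ + _]coefXM [X in X * _ + _]/=; ring.
(* The case [j = m] is the one that fixes the constant [t]. *)
rewrite jm in sD' cD' sXD' *.
rewrite [L (P m.+1 * ('X * ('X * D')))]orth_lead ?size_leXM // 2!coefXM.
have -> : (if m.+1 == 0 then 0 else if m.+1.-1 == 0 then 0 else D'`_m.+1.-1.-1)
    = - m%:R :> R by case: (m) cD' => //=; rewrite oppr0.
have -> : P m.+1 * ('X * ('X * P m)) = ('X * P m) * ('X * P m.+1).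
  exact: swapX.
have XPm : 'X * P m = P m.+1 + b m *: P m + beta m *: P m.-1.
  by rewrite (monic_recurrence nN') -!mul_polyC; ring.
have PmX : beta m * L (P m.-1 * ('X * P m.+1)) = 0.
  case: (m) nN' => [|k] kN; first by rewrite mul0r.
  have kN' : (k <= N)%N by rewrite ltnW // ltnW.
  by rewrite swapX orth_lt_size ?mulr0 // sizeXP.
have XPP : L (P m * ('X * P m.+1)) = h m.+1.
  by rewrite swapX node_sumXPP.
rewrite (_ : 'X * P m * _ = P m.+1 * ('X * P m.+1) + b m *: (P m * ('X * P m.+1)) +
    beta m *: (P m.-1 * ('X * P m.+1))); last first.
  by rewrite {1}XPm -!mul_polyC; ring.
rewrite !node_sumD !node_sumZ PmX XPP node_sumXPP //.
rewrite -!diag_coefM // -/(h m).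
have -> : beta m.+1 * (b m * h m) = b m * h m.+1 by rewrite -betaM; ring.
have -> : t * (beta m.+1 * h m) = t * h m.+1 by rewrite betaM.
rewrite /t -natr1; ring.
Qed.

Let sub_coefZ n : (n < N)%N ->
  beta n *: P n.-1 = ('X - (b n)%:P) * P n - P n.+1.
Proof. by move=> nN; rewrite (monic_recurrence nN) opprB addrC subrK. Qed.

Lemma endpoint_relation n : (n < N)%N ->
  (b n + c + (N%:R + 1 - alpha) - n%:R) *
    ((N%:R - b n) * (P n).[N%:R] - (P n.+1).[N%:R]) =
  (c * n%:R + beta n) * (P n).[N%:R].
Proof.
move=> nN; have := congr1 (fun q => q.[N%:R]) (structure_relation nN).
rewrite sub_coefZ //.
rewrite !(hornerD, hornerN, hornerZ, hornerM, hornerC, hornerX) subrr mul0r mulr0.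
by move=> /esym/eqP; rewrite -subr_eq0 => /eqP E; apply/eqP; rewrite -subr_eq0 -E; apply/eqP; ring.
Qed.

(** The functional [L'] is applied to the structure relation, whose left side becomes [L ('X * P n)]
    by [cauchy_pearson]. *)
Lemma cauchy_relation n : (n < N)%N ->
  (c * (N%:R + 1 - alpha - n%:R) - beta n) * L' (P n) +
  (b n + c - n%:R) * ((alpha - 1 - b n) * L' (P n) - L' (P n.+1)) = 0.
Proof.
move=> nN; have nN' := ltnW nN; set a := alpha - 1.
(* The factor [n] makes this true at [n = 0] as well, where [L (P 0)] is nonzero. *)
have LP0 : n%:R * L (P n) = 0.
  case: (n) nN' => [|m] mN; first by rewrite mul0r.
  by rewrite -[P _]mulr1 orth_lt_size ?mulr0 // size_poly1.
have LP1 : L (P n.+1) = 0.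
  by rewrite -[P _]mulr1 orth_lt_size // size_poly1.
have := congr1 L' (structure_relation nN).
rewrite node_sumZ -cauchy_pearson sub_coefZ //.
set t := b n + c - alpha - n%:R + 1; set m := c * (N%:R - n%:R) - beta n.
(* Each ['X] is split as [('X - a%:P) + a%:P], since a factor ['X - a%:P] turns [L'] into [L]. *)
have -> : (m%:P - c *: 'X) * P n + ('X + t%:P) * (('X - (b n)%:P) * P n - P n.+1) =
    (m - c * a) *: P n - c *: (P n * ('X - a%:P)) +
    ('X * P n - b n *: P n - P n.+1) * ('X - a%:P) +
    (t + a) *: (P n * ('X - a%:P) + (a - b n) *: P n - P n.+1).
  by rewrite -!mul_polyC !(polyCB, polyCD, polyCM); ring.
rewrite !(node_sumD, node_sumN, node_sumZ) !node_sum_cauchyM.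
rewrite !(node_sumD, node_sumN, node_sumZ) LP1.
move=> E; rewrite /m /t in E; rewrite /a in E *; lra.
Qed.

(** * Nonvanishing and signs at [N] and at [alpha - 1] *)

Lemma monic_divXsubC (q : {poly R}) m a : q \is monic -> size q = m.+2 ->
  exists r, [/\ r \is monic, size r = m.+1 & q = r * ('X - a%:P) + q.[a]%:P].
Proof.
move=> mq sq.
have /factor_theorem[r rE] : root (q - q.[a]%:P) a by rewrite rootE !hornerE subrr.
have qE : q = r * ('X - a%:P) + q.[a]%:P by rewrite -rE subrK.
have sqC : (size (- q.[a]%:P)%R < size q)%N.
  by rewrite size_polyN sq (leq_ltn_trans (size_polyC_leq1 _)).
exists r; split => //.
  by rewrite -(monicMr r (monicXsubC a)) -rE monicE lead_coefDl -?monicE.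
have : size (r * ('X - a%:P)) = m.+2 by rewrite -rE size_polyDl.
have [->|r0] := eqVneq r 0; first by rewrite mul0r size_poly0.
by rewrite size_Mmonic ?monicXsubC // size_XsubC addn2 => -[].
Qed.

(* L' q is the Cauchy transform of q w at alpha - 1: splitting off q(alpha - 1)
   from one factor cancels the denominator in the other term. *)
Lemma cauchy_sqrE q m : q \is monic -> size q = m.+2 -> L' q = 0 ->
  exists r, [/\ r \is monic, size r = m.+1 & L' (q * q) = L (q * r)].
Proof.
move=> mq sq Lq0; have [r [mr sr qE]] := monic_divXsubC (alpha - 1) mq sq.
exists r; split => //; rewrite {2}qE mulrDr node_sumD mulrA node_sum_cauchyM.
by rewrite [q * _%:P]mulrC node_sumCM Lq0 mulr0 addr0.
Qed.

Lemma cauchy_sqr_gt0 q : (size q <= N.+1)%N -> q != 0 -> 0 < L' (q * q).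
Proof.
by apply: node_sum_sqr_gt0 => // k kN; first exact/ltW/w'_gt0.
Qed.

(** If [L' (P n)] vanished with [n > 0], then [L' (P n * P n)] would equal [L (P n * r)] with [r] of
    degree [n - 1], which is 0 by orthogonality. *)
Lemma cauchy_neq0 n : (n <= N)%N -> L' (P n) != 0.
Proof.
move=> nN; have := @cauchy_sqr_gt0 (P n); rewrite sizeP // monic_neq0 ?monP //.
move=> /(_ nN isT); case: n nN => [|m] mN.
  have /monicP := monP mN; rewrite (size1_polyC (eq_leq (sizeP mN))) lead_coefC => ->.
  by rewrite mulr1 => /gt_eqF ->.
apply: contraTneq => /(cauchy_sqrE (monP mN) (sizeP mN))[r [_ sr ->]].
by rewrite orth_lt_size ?sr ?ltxx.
Qed.

Lemma monic_subZ n a : (n < N)%N ->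
  P n.+1 - a *: P n \is monic /\ size (P n.+1 - a *: P n) = n.+2.
Proof.
move=> nN; have s_lt : (size (- (a *: P n))%R < size (P n.+1))%N.
  by rewrite size_polyN sizeP // ltnS size_leZ // sizeP // ltnW.
by rewrite monicE lead_coefDl // size_polyDl // sizeP // -monicE monP.
Qed.

Lemma node_sum_subZ_monic n a r : (n < N)%N -> r \is monic -> size r = n.+1 ->
  L ((P n.+1 - a *: P n) * r) = - a * h n.
Proof.
move=> nN mr sr; rewrite mulrBl node_sumB -scalerAl node_sumZ.
rewrite orth_lt_size ?sr // orth_lead ?sr //; last exact: ltnW.
by move/monicP: mr; rewrite lead_coefE sr => ->; rewrite mul1r sub0r mulNr.
Qed.

(** For the ratio [v], the polynomial [q = P n.+1 - v *: P n] has [L' q = 0], so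
    [0 < L' (q * q) = L (q * r) = - v * h n]. *)
Lemma cauchy_ratio_lt0 n : (n < N)%N -> L' (P n.+1) / L' (P n) < 0.
Proof.
move=> nN; set v := _ / _; have [mq sq] := monic_subZ v nN.
have Lq0 : L' (P n.+1 - v *: P n) = 0.
  by rewrite node_sumB node_sumZ divfK ?subrr // cauchy_neq0 // ltnW.
have [r [mr sr LE]] := cauchy_sqrE mq sq Lq0.
have := @cauchy_sqr_gt0 (P n.+1 - v *: P n).
rewrite sq monic_neq0 // LE node_sum_subZ_monic // => /(_ nN isT).
by rewrite pmulr_lgt0 ?oppr_gt0 // sqnorm_gt0 // ltnW.
Qed.

(** By the recurrence the left side is [beta n * L' (P n.-1) / L' (P n)] for [n > 0], negative by
    the previous lemma; at [n = 0] it is [- L (P 0) / L' (P 0)]. *)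
Lemma cauchy_drift_lt0 n : (n < N)%N ->
  alpha - 1 - b n - L' (P n.+1) / L' (P n) < 0.
Proof.
move=> nN; have nN' := ltnW nN; have S0 := cauchy_neq0 nN'.
have : L' (beta n *: P n.-1) =
    L (P n) + (alpha - 1 - b n) * L' (P n) - L' (P n.+1).
  rewrite sub_coefZ // -node_sum_cauchyM -node_sumZ -node_sumD -node_sumB.
  by congr node_sum; rewrite -!mul_polyC !polyCB; ring.
rewrite node_sumZ.
have -> : alpha - 1 - b n - L' (P n.+1) / L' (P n) =
    ((alpha - 1 - b n) * L' (P n) - L' (P n.+1)) / L' (P n) by field.
case: (n) nN' nN S0 => [|m] mN' mN S0 E.
  have P0 : P 0 = 1.
    have /monicP := monP mN'.
    by rewrite (size1_polyC (eq_leq (sizeP mN'))) lead_coefC => ->.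
  have L0 : 0 < L (P 0).
    by have := sqnorm_gt0 mN'; rewrite /sqnorm {1}P0 mul1r.
  have S0' : 0 < L' (P 0).
    rewrite P0 -[X in L' X]mulr1; apply: cauchy_sqr_gt0; last exact: oner_neq0.
    by rewrite size_poly1.
  by rewrite pmulr_llt0 ?invr_gt0 //; move: E; rewrite /= mul0r; lra.
have LP0 : L (P m.+1) = 0.
  by rewrite -[P _]mulr1 orth_lt_size // size_poly1.
rewrite LP0 add0r [m.+1.-1]/= in E; rewrite -E -mulrA -invf_div.
by rewrite (pmulr_rlt0 _ (sub_coef_gt0 mN')) invr_lt0 cauchy_ratio_lt0.
Qed.

Lemma node_sum_endpoint_lt0 q : (size q <= N)%N -> q != 0 ->
  L (q * ('X - N%:R%:P) * q) < 0.
Proof.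
move=> sq q0; rewrite -oppr_gt0 -node_sumN.
have -> : L (- (q * ('X - N%:R%:P) * q)) =
    node_sum N (fun k => (N%:R - k%:R) * w k) (q * q).
  apply: eq_node_sum => k _; rewrite hornerN !hornerM hornerXsubC; ring.
apply: node_sum_sqr_gt0 sq q0 => // k kN.
  by rewrite mulr_ge0 ?subr_ge0 ?ler_nat // ltW // w_gt0.
by rewrite mulr_gt0 ?subr_gt0 ?ltr_nat // w_gt0 // ltnW.
Qed.

(** A zero at [N] would give [P n = r * ('X - N%:R%:P)]; then [L (P n * r)] is both 0 by
    orthogonality and negative. *)
Lemma endpoint_neq0 n : (n <= N)%N -> (P n).[N%:R] != 0.
Proof.
case: n => [|m] mN.
  have /monicP := monP mN; rewrite (size1_polyC (eq_leq (sizeP mN))) lead_coefC => ->.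
  by rewrite hornerC oner_eq0.
have [r [mr sr PE]] := monic_divXsubC N%:R (monP mN) (sizeP mN).
apply/eqP => P0; rewrite P0 addr0 in PE.
have := @node_sum_endpoint_lt0 r; rewrite sr -PE orth_lt_size ?sr // ltxx.
by move=> /(_ mN (monic_neq0 mr)).
Qed.

(* P_{n+1} - u P_n vanishes at N, hence equals (x - N) r, and
   - u h_n = L ((x - N) r^2) < 0. *)
Lemma endpoint_ratio_gt0 n : (n < N)%N -> 0 < (P n.+1).[N%:R] / (P n).[N%:R].
Proof.
move=> nN; set u := _ / _; have [mq sq] := monic_subZ u nN.
have [r [mr sr]] := monic_divXsubC N%:R mq sq.
have -> : (P n.+1 - u *: P n).[N%:R] = 0.
  by rewrite hornerD hornerN hornerZ divfK ?subrr // endpoint_neq0 // ltnW.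
rewrite addr0 => qE.
have := @node_sum_endpoint_lt0 r; rewrite sr -qE node_sum_subZ_monic //.
move=> /(_ nN (monic_neq0 mr)).
by rewrite pmulr_llt0 ?oppr_lt0 // sqnorm_gt0 // ltnW.
Qed.
End StructureRelation.

End MonicOrthogonal.

(** * Deformation in c *)

Section DerivativeRules.
Variable R : realType.
Implicit Types (f g : R -> R) (x df dg : R).

Lemma is_derive1D f g x df dg : is_derive x 1 f df -> is_derive x 1 g dg ->
  is_derive x 1 (fun y => f y + g y) (df + dg).
Proof. by move=> Hf Hg; apply: is_deriveD. Qed.

Lemma is_derive1B f g x df dg : is_derive x 1 f df -> is_derive x 1 g dg ->
  is_derive x 1 (fun y => f y - g y) (df - dg).
Proof. by move=> Hf Hg; apply: is_deriveB. Qed.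

Lemma is_derive1M f g x df dg : is_derive x 1 f df -> is_derive x 1 g dg ->
  is_derive x 1 (fun y => f y * g y) (f x * dg + g x * df).
Proof. by move=> Hf Hg; apply: is_deriveM. Qed.

Lemma is_derive1_div f g x df dg : g x != 0 ->
  is_derive x 1 f df -> is_derive x 1 g dg ->
  is_derive x 1 (fun y => f y / g y) ((df * g x - f x * dg) / g x ^+ 2).
Proof.
move=> gx0 Hf Hg.
have HV : is_derive x 1 (fun y => (g y)^-1) (- (g x) ^- 2 * dg).
  have dg' : derivable g x 1 by case: Hg.
  apply: DeriveDef; first exact: derivableV.
  by rewrite deriveV // derive_val.
apply: is_derive_eq (is_derive1M Hf HV) _.
by field.
Qed.

(** The identities in [c] hold only for [c > 0], an open condition, so derivatives still
    transfer. *)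
Lemma is_derive1_pos_ext f g x df : 0 < x -> (forall y, 0 < y -> f y = g y) ->
  is_derive x 1 f df -> is_derive x 1 g df.
Proof.
move=> x0 fg; apply: near_eq_is_derive.
by near=> y; apply: fg; near: y; exact: lt_nbhsr.
Unshelve. all: by end_near. Qed.

Lemma is_derive1_pos_eq f g x df dg : 0 < x -> (forall y, 0 < y -> f y = g y) ->
  is_derive x 1 f df -> is_derive x 1 g dg -> df = dg.
Proof. by move=> x0 fg /(is_derive1_pos_ext x0 fg)[_ <-] [_ <-]. Qed.

End DerivativeRules.

(** * Toda-type equations for a weight with [c w' = k w] *)

Section WeightDeformation.
Variables (R : realType) (N : nat) (W : R -> nat -> R).
Hypothesis W_derive : forall (c : R) k, 0 < c -> (k <= N)%N ->
  is_derive c 1 (fun x => W x k) (k%:R * W c k / c).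

Lemma is_derive_node_sum (Q : R -> {poly R}) (Q' : {poly R}) (c : R) : 0 < c ->
  (forall k : nat, is_derive c 1 (fun x => (Q x).[k%:R]) Q'.[k%:R]) ->
  is_derive c 1 (fun x => node_sum N (W x) (Q x))
    (node_sum N (W c) Q' + node_sum N (W c) ('X * Q c) / c).
Proof.
move=> c0 HQ; rewrite /node_sum mulr_suml -big_split /=.
pose F (k : 'I_N.+1) x := (Q x).[k%:R] * W x k.
have -> : (fun x => \sum_(k < N.+1) (Q x).[k%:R] * W x k) = \sum_(k < N.+1) F k.
  by apply/funext => x; rewrite fct_sumE.
apply: is_derive_sum => k; have kN : (k <= N)%N by rewrite -ltnS.
apply: is_derive_eq (is_derive1M (HQ k) (W_derive c0 kN)) _.
by rewrite hornerM hornerX; ring.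
Qed.

Variable P : R -> nat -> {poly R}.
Hypothesis W_gt0 : forall c : R, 0 < c -> forall k, (k <= N)%N -> 0 < W c k.
Hypothesis P_orth : forall c : R, 0 < c -> monic_orthogonal N (W c) (P c).
Local Notation h j c := (sqnorm N (W c) (P c) j).
Local Notation b j c := (diag_coef N (W c) (P c) j).
Local Notation beta j c := (sub_coef N (W c) (P c) j).

(** The expected derivative of [P j]. Assuming it at [j] and [j.-1] yields the derivatives of [h],
    [beta] and [b], and the recurrence then yields it at [j.+1]. *)
Let dP j c := - (beta j c / c) *: P c j.-1.
Let P_derivable j := forall c x : R, 0 < c ->
  is_derive c 1 (fun y => (P y j).[x]) (dP j c).[x].

(** The derivative of [P j] is orthogonal to [P j], so only the weight contributes. *)
Let is_derive_sqnorm j : (j <= N)%N -> P_derivable j ->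
  forall c : R, 0 < c -> is_derive c 1 (fun y => h j y) (b j c * h j c / c).
Proof.
move=> jN HP c c0.
pose Q' := dP j c * P c j + P c j * dP j c.
have HQ (k : nat) : is_derive c 1 (fun y => (P y j * P y j).[k%:R]) Q'.[k%:R].
  have -> : (fun y => (P y j * P y j).[k%:R]) =
      (fun y => (P y j).[k%:R] * (P y j).[k%:R]).
    by apply/funext => y; rewrite hornerM.
  apply: is_derive_eq (is_derive1M (HP c k%:R c0) (HP c k%:R c0)) _.
  by rewrite hornerD !hornerM; ring.
apply: is_derive_eq (is_derive_node_sum c0 HQ) _.
have jb := diag_coefM (W_gt0 c0) (P_orth c0) jN.
have -> : node_sum N (W c) Q' = 0.
  have -> : Q' = (- (2 / c)) *: (beta j c *: (P c j.-1 * P c j)).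
    by rewrite /Q' /dP -!mul_polyC !polyCN !polyCM; ring.
  by rewrite !node_sumZ (sub_coef_orth (P_orth c0) jN) mulr0.
by rewrite add0r mulrCA jb.
Qed.

Let is_derive_sub_coef j : (j <= N)%N -> P_derivable j -> P_derivable j.-1 ->
  forall c : R, 0 < c ->
  is_derive c 1 (fun y => beta j y) (beta j c * (b j c - b j.-1 c) / c).
Proof.
case: j => [|j] jN HP HP' c c0 /=.
  by rewrite !mul0r; exact: is_derive_cst.
have h0 := sqnorm_gt0 (W_gt0 c0) (P_orth c0) (ltnW jN).
have hj0 : h j c != 0 by rewrite gt_eqF.
apply: is_derive_eq (is_derive1_div hj0
  (is_derive_sqnorm jN HP c0) (is_derive_sqnorm (ltnW jN) HP' c0)) _.
by field; rewrite hj0 gt_eqF.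
Qed.

Let is_derive_diag_coef j : (j < N)%N -> P_derivable j ->
  forall c : R, 0 < c ->
  is_derive c 1 (fun y => b j y) ((beta j.+1 c - beta j c) / c).
Proof.
move=> jN HP c c0.
pose Q' := 2 *: (dP j c * ('X * P c j)).
have HQ (k : nat) : is_derive c 1 (fun y => (P y j * ('X * P y j)).[k%:R]) Q'.[k%:R].
  have -> : (fun y => (P y j * ('X * P y j)).[k%:R]) =
      (fun y => (k%:R * (P y j).[k%:R]) * (P y j).[k%:R]).
    by apply/funext => y; rewrite !hornerM hornerX; ring.
  have Hk := is_derive1M (is_derive_cst (k%:R : R) c 1) (HP c k%:R c0).
  apply: is_derive_eq (is_derive1M Hk (HP c k%:R c0)) _.
  by rewrite /Q' [RHS]hornerZ !hornerM hornerX /=; ring.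
have h0 := sqnorm_gt0 (W_gt0 c0) (P_orth c0) (ltnW jN).
have hj0 : h j c != 0 by rewrite gt_eqF.
apply: is_derive_eq (is_derive1_div hj0
  (is_derive_node_sum c0 HQ) (is_derive_sqnorm (ltnW jN) HP c0)) _.
rewrite (_ : node_sum N (W c) Q' = - (2 / c) * (beta j c * h j c)); last first.
  rewrite -(sub_coef_node_sum (P_orth c0) (ltnW jN)) -!node_sumZ.
  by congr node_sum; rewrite /Q' /dP -!mul_polyC !polyCN !polyCM; ring.
rewrite mulrA (node_sum_sqrX (W_gt0 c0) (P_orth c0) jN).
rewrite -(diag_coefM (W_gt0 c0) (P_orth c0) (ltnW jN)).
by field; rewrite hj0 gt_eqF.
Qed.

Let P_derivable_pred j : (j <= N)%N -> P_derivable j /\ P_derivable j.-1.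
Proof.
elim: j => [_|j IHj jN].
  suff H0 : P_derivable 0 by [].
  move=> c x c0; apply: (is_derive1_pos_ext c0 (f := fun=> 1)) => [y y0|].
    have [/(_ 0 isT)[s0 m0] _] := P_orth y0.
    have /monicP := m0; rewrite (size1_polyC (eq_leq s0)) lead_coefC => ->.
    by rewrite hornerC.
  by rewrite /dP /= mul0r oppr0 scale0r horner0; exact: is_derive_cst.
have [HP HP'] := IHj (ltnW jN); split => //= c x c0.
apply: (is_derive1_pos_ext c0
  (f := fun y => (x - b j y) * (P y j).[x] - beta j y * (P y j.-1).[x])) => [y y0|].
  rewrite (monic_recurrence (W_gt0 y0) (P_orth y0) jN).
  by rewrite !(hornerD, hornerN, hornerM, hornerZ, hornerX, hornerC).
have Hb := is_derive1B (is_derive_cst (x : R) c 1) (is_derive_diag_coef jN HP c0).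
have Hbt := is_derive_sub_coef (ltnW jN) HP HP' c0.
apply: is_derive_eq (is_derive1B (is_derive1M Hb (HP c x c0)) (is_derive1M Hbt (HP' c x c0))) _.
rewrite /dP !hornerZ /=.
(* The recurrence one index lower; the factor [beta j c] makes it valid at [j = 0]. *)
have E : beta j c * ((P c j).[x] - (x - b j.-1 c) * (P c j.-1).[x]
    + beta j.-1 c * (P c j.-1.-1).[x]) = 0.
  case: (j) jN => [|i] iN /=; first by rewrite mul0r.
  rewrite (monic_recurrence (W_gt0 c0) (P_orth c0) (ltnW iN)).
  by rewrite !(hornerD, hornerN, hornerM, hornerZ, hornerX, hornerC) /=; ring.
rewrite -/(beta j.+1 c); apply/eqP; rewrite -subr_eq0; apply/eqP.
rewrite sub0r -[RHS](mulr0 c^-1) -E.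
by field; rewrite gt_eqF.
Qed.

Lemma is_derive_orthogonal j (c x : R) : (j <= N)%N -> 0 < c ->
  is_derive c 1 (fun y => (P y j).[x]) (- (beta j c / c) *: P c j.-1).[x].
Proof. by move=> /P_derivable_pred[+ _]; apply. Qed.

Lemma is_derive_diag j (c : R) : (j < N)%N -> 0 < c ->
  is_derive c 1 (fun y => b j y) ((beta j.+1 c - beta j c) / c).
Proof.
by move=> jN; apply: is_derive_diag_coef => //; have [] := P_derivable_pred (ltnW jN).
Qed.

End WeightDeformation.

(** * The Painleve function *)

(* y1, y2, b1 and v1 stand for the derivatives y', y'', b' and v' in c; bt and
   bt1 for beta_n and beta_{n+1}. *)
Lemma pv_algebra (F : numFieldType) (N n alpha c y b v bt bt1 y1 y2 v1 b1 : F) :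
  let K := N + 1 - alpha in
  let g := b + c + K - n in
  let u := K * y + v in
  c != 0 -> y != 0 -> y - 1 != 0 ->
  g * (N - b - u) = c * n + bt ->
  v = alpha - 1 - b - c + g * (1 - y) ->
  c * y1 = v * (1 - 2 * y) - K * y ^+ 2 + (N - b) * y ->
  c * b1 = bt1 - bt ->
  c * v1 = - bt1 + (alpha - 1 - b) * v - v ^+ 2 ->
  v1 = - (b1 + 1) * y - g * y1 ->
  c * y2 + y1 = v1 * (1 - 2 * y) - 2 * v * y1 - 2 * K * y * y1 + (N - b) * y1 - b1 * y ->
  y2 =
    (1 / (2 * y) + 1 / (y - 1)) * y1 ^+ 2
    - y1 / c
    + (y - 1) ^+ 2 / c ^+ 2 * ((alpha - N - 1) ^+ 2 / 2 * y + (- ((n - N) ^+ 2 / 2)) / y)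
    + (- (n + alpha)) * y / c
    + (- (1 / 2)) * y * (y + 1) / (y - 1).
Proof.
move=> K g u c0 y0 y10 E1 E2 Ey Eb Ev Ev' Eyy.
have {}Ey : y1 = (v * (1 - 2 * y) - K * y ^+ 2 + (N - b) * y) / c by rewrite -Ey mulrC mulKf.
have {}Eb : b1 = (bt1 - bt) / c by rewrite -Eb mulrC mulKf.
have {}E1 : bt = g * (N - b - u) - c * n by rewrite E1 addrC addKr.
(* Equating the two expressions of [v1] in [Ev] and [Ev'] gives a linear equation for [bt1] with
   coefficient [1 - y]. *)
have Ebt1 : bt1 = ((alpha - 1 - b) * v - v ^+ 2 + c * g * y1 + (c - bt) * y) / (1 - y).
  apply: (canRL (mulfK _)); first by rewrite -oppr_eq0 opprB.
  have -> : c * g * y1 = - c * v1 - (bt1 - bt + c) * y.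
    rewrite Ev' -[bt1 - bt](divfK c0) -Eb; ring.
  rewrite mulNr Ev; ring.
have -> : y2 = (v1 * (1 - 2 * y) - 2 * v * y1 - 2 * K * y * y1 + (N - b) * y1 - b1 * y - y1) / c.
  by rewrite -Eyy addrK mulrC mulKf.
rewrite Ev' Eb Ebt1 Ey E1 /u E2 /g /K.
field.
rewrite y10 y0 c0 -oppr_eq0 opprB y10 /=.
done.
Qed.

Section PainleveFunction.
Variables (R : realType) (N n : nat) (alpha : R).
Variables (W : R -> nat -> R) (P : R -> nat -> {poly R}).
Hypothesis W_gt0 : forall c : R, 0 < c -> forall k, (k <= N)%N -> 0 < W c k.
Hypothesis W_derive : forall (c : R) k, 0 < c -> (k <= N)%N ->
  is_derive c 1 (fun x => W x k) (k%:R * W c k / c).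
Hypothesis W_ratio : forall c : R, 0 < c -> forall k, (k < N)%N ->
  k.+1%:R * (k.+1%:R - alpha) * W c k.+1 = c * (N%:R - k%:R) * W c k.
Hypothesis P_orth : forall c : R, 0 < c -> monic_orthogonal N (W c) (P c).
Implicit Types c : R.
Hypothesis alpha_lt1 : alpha < 1.
Hypothesis nN : (n < N)%N.

Let b c := diag_coef N (W c) (P c) n.
Let bt c := sub_coef N (W c) (P c) n.
Let bt1 c := sub_coef N (W c) (P c) n.+1.
Let K : R := N%:R + 1 - alpha.
Let g c := b c + c + K - n%:R.
Let W' c k := W c k / (k%:R + 1 - alpha).
Let u c := (P c n.+1).[N%:R] / (P c n).[N%:R].
Let v c := node_sum N (W' c) (P c n.+1) / node_sum N (W' c) (P c n).

Definition painleve_fun c := (u c - v c) / K.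
Local Notation y := painleve_fun.

Let K_gt0 : 0 < K.
Proof. by rewrite /K -addrA ltr_wpDl ?ler0n // subr_gt0. Qed.

Let uE c : u c = K * y c + v c.
Proof. by rewrite mulrC divfK ?subrK // gt_eqF. Qed.

Let g_gt0 c : 0 < c -> 0 < g c.
Proof.
move=> c0; have := diag_coef_ge0 (W_gt0 c0) (P_orth c0) (ltnW nN).
rewrite -/(b c) /g /K => b0.
have : n%:R + 1 <= N%:R :> R by rewrite natr1 ler_nat.
by have := alpha_lt1; lra.
Qed.

Let num_u_neq0 c : 0 < c -> (P c n).[N%:R] != 0.
Proof. by move=> c0; apply: endpoint_neq0 (W_gt0 c0) (P_orth c0) _ _; exact: ltnW. Qed.

Let den_v_neq0 c : 0 < c -> node_sum N (W' c) (P c n) != 0.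
Proof.
by move=> c0; apply: (cauchy_neq0 (W_gt0 c0) (P_orth c0)) => //; exact: ltnW.
Qed.

Lemma endpoint_eq c : 0 < c ->
  g c * (N%:R - b c - (K * y c + v c)) = c * n%:R + bt c.
Proof.
move=> c0; have := endpoint_relation (W_gt0 c0) (P_orth c0) alpha_lt1 (W_ratio c0) nN.
rewrite -uE -/(b c) -/(bt c) -/K -/(g c) => E.
apply: (mulIf (num_u_neq0 c0)); rewrite -E /u.
by field; exact: num_u_neq0.
Qed.

(** Substituting [bt] from [endpoint_eq] into the Cauchy relation leaves [K] times this identity. *)
Lemma cauchy_eq c : 0 < c -> v c = alpha - 1 - b c - c + g c * (1 - y c).
Proof.
move=> c0; have := cauchy_relation (W_gt0 c0) (P_orth c0) alpha_lt1 (W_ratio c0) nN.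
rewrite -/(b c) -/(bt c) -/(W' c) -/K => E.
have {}E : c * (K - n%:R) - bt c + (b c + c - n%:R) * (alpha - 1 - b c - v c) = 0.
  apply: (mulIf (den_v_neq0 c0)); rewrite mul0r -E /v.
  by field; exact: den_v_neq0.
have E1 := endpoint_eq c0.
have KE : K * (v c - (alpha - 1 - b c - c + g c * (1 - y c))) = 0.
  rewrite -E (_ : bt c = g c * (N%:R - b c - (K * y c + v c)) - c * n%:R); last by rewrite E1; ring.
  by rewrite /g /K; ring.
by move/eqP: KE; rewrite mulf_eq0 gt_eqF //= subr_eq0 => /eqP.
Qed.

Lemma painleve_fun_gt0 c : 0 < c -> 0 < y c.
Proof.
move=> c0; rewrite divr_gt0 // subr_gt0.
have := endpoint_ratio_gt0 (W_gt0 c0) (P_orth c0) nN.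
by have := cauchy_ratio_lt0 (W_gt0 c0) (P_orth c0) alpha_lt1 nN; apply: lt_trans.
Qed.

(** [K - (u - v)] is [N - b - u], nonnegative by [endpoint_eq], minus the negative quantity of
    [cauchy_drift_lt0]. *)
Lemma painleve_fun_lt1 c : 0 < c -> y c < 1.
Proof.
move=> c0; rewrite ltr_pdivrMr // mul1r.
have := cauchy_drift_lt0 (W_gt0 c0) (P_orth c0) alpha_lt1 nN.
rewrite -/(b c) -/(W' c) -/(v c).
have : 0 <= N%:R - b c - u c.
  rewrite -(pmulr_rge0 _ (g_gt0 c0)) uE endpoint_eq // addr_ge0 //.
    by rewrite mulr_ge0 // ltW.
  exact: (sub_coef_ge0 (W_gt0 c0) (P_orth c0) (ltnW nN)).
by rewrite /K; lra.
Qed.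

Let is_derive_u c : 0 < c ->
  is_derive c 1 u ((- bt1 c - u c * (u c - N%:R + b c)) / c).
Proof.
move=> c0.
have Hn := is_derive_orthogonal W_derive W_gt0 P_orth N%:R (ltnW nN) c0.
have Hn1 := is_derive_orthogonal W_derive W_gt0 P_orth N%:R nN c0.
have H := is_derive1_div (x := c) (g := fun c => (P c n).[N%:R]) (num_u_neq0 c0) Hn1 Hn.
apply: is_derive_eq H _.
have btE : bt c * (P c n.-1).[N%:R] = (N%:R - b c) * (P c n).[N%:R] - (P c n.+1).[N%:R].
  rewrite (monic_recurrence (W_gt0 c0) (P_orth c0) nN).
  by rewrite !(hornerD, hornerN, hornerM, hornerZ, hornerX, hornerC) /bt /b; ring.
have Pn0 := num_u_neq0 c0.
rewrite !hornerZ -/(bt c) -/(bt1 c) [n.+1.-1]/=.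
rewrite [- (bt c / c) * _](_ : _ = - (bt c * (P c n.-1).[N%:R]) / c); last by ring.
by rewrite btE /u; field; rewrite Pn0 gt_eqF.
Qed.

(** The denominators of [W'] are free of [c], so [is_derive_node_sum] applies to Cauchy transforms
    too. *)
Let W'_derive (c : R) k : 0 < c -> (k <= N)%N ->
  is_derive c 1 (fun x => W' x k) (k%:R * W' c k / c).
Proof.
move=> c0 kN.
have H := is_derive1M (W_derive c0 kN)
  (is_derive_cst ((k%:R + 1 - alpha)^-1 : R) c 1).
by apply: is_derive_eq H _; rewrite /W' mulr0 add0r /=; ring.
Qed.

Let is_derive_v c : 0 < c ->
  is_derive c 1 v ((- bt1 c + (alpha - 1 - b c) * v c - v c ^+ 2) / c).
Proof.
move=> c0.
have Hn := is_derive_node_sum W'_derive c0 (fun k : nat =>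
  is_derive_orthogonal W_derive W_gt0 P_orth k%:R (ltnW nN) c0).
have Hn1 := is_derive_node_sum W'_derive c0 (fun k : nat =>
  is_derive_orthogonal W_derive W_gt0 P_orth k%:R nN c0).
have H := is_derive1_div (x := c) (g := fun c => node_sum N (W' c) (P c n)) (den_v_neq0 c0) Hn1 Hn.
apply: is_derive_eq H _.
have S0 := den_v_neq0 c0.
have HS : node_sum N (W' c) (- (bt c / c) *: P c n.-1) +
    node_sum N (W' c) ('X * P c n) / c =
    (b c * node_sum N (W' c) (P c n) + node_sum N (W' c) (P c n.+1)) / c.
  rewrite ![_ / c]mulrC -!node_sumZ -!node_sumD -!node_sumZ; congr node_sum.
  by rewrite (monic_recurrenceZ (W_gt0 c0) (P_orth c0) _ nN).
(* Under the Cauchy transform of [P n.+1], ['X] acts as [alpha - 1], because [P n.+1] has zero sum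
   against [W]. *)
have HS1 : node_sum N (W' c) ('X * P c n.+1) = (alpha - 1) * node_sum N (W' c) (P c n.+1).
  have L0 : node_sum N (W c) (P c n.+1) = 0.
    by rewrite -[P c _]mulr1 (orth_lt_size (P_orth c0)) // size_poly1.
  have := node_sum_cauchyM N (W c) alpha_lt1 (P c n.+1).
  rewrite L0 mulrBr node_sumB ![P c n.+1 * _]mulrC node_sumCM => /eqP.
  by rewrite subr_eq0 => /eqP.
rewrite -/(bt c) HS HS1 node_sumZ -/(bt1 c) [n.+1.-1]/= /v.
by field; rewrite S0 gt_eqF.
Qed.

(** The derivative of [y]: [bt1] cancels between the Riccati equations of [u] and [v]. *)
Let y1 c := (v c * (1 - 2 * y c) - K * y c ^+ 2 + (N%:R - b c) * y c) / c.

Let is_derive_y c : 0 < c -> is_derive c 1 y (y1 c).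
Proof.
move=> c0.
have H := is_derive1M (is_derive1B (is_derive_u c0) (is_derive_v c0))
  (is_derive_cst (K^-1 : R) c 1).
apply: is_derive_eq H _.
rewrite mulr0 add0r uE /y1 /=.
have cN0 : c != 0 by rewrite gt_eqF.
have KN0 : K != 0 by rewrite gt_eqF.
have -> : N%:R = K + alpha - 1 by rewrite /K; ring.
by field; rewrite cN0 KN0.
Qed.

Lemma derive1_painleve_fun c : 0 < c -> derive1 y c = y1 c.
Proof. by move=> c0; rewrite derive1E; have [_ ->] := is_derive_y c0. Qed.

Lemma painleve_fun_ode c : 0 < c ->
  twice_derivable y c /\
  painleveV ((alpha - N%:R - 1) ^+ 2 / 2) (- ((n%:R - N%:R) ^+ 2 / 2))
    (- (n%:R + alpha)) (- (1 / 2)) y c.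
Proof.
move=> c0; have cN0 : c != 0 by rewrite gt_eqF.
have Hy := is_derive_y c0; have Hv := is_derive_v c0.
have Hb : is_derive c 1 b ((bt1 c - bt c) / c) := is_derive_diag W_derive W_gt0 P_orth nN c0.
pose v1 := (- bt1 c + (alpha - 1 - b c) * v c - v c ^+ 2) / c.
pose b1 := (bt1 c - bt c) / c.
have Hnum : is_derive c 1
    (fun x => v x * (1 - 2 * y x) - K * y x ^+ 2 + (N%:R - b x) * y x)
    (v1 * (1 - 2 * y c) - 2 * v c * y1 c - 2 * K * y c * y1 c +
     (N%:R - b c) * y1 c - b1 * y c).
  have Hcst (a : R) := is_derive_cst a c (1 : R).
  have H := is_derive1D (is_derive1B
    (is_derive1M Hv (is_derive1B (Hcst 1) (is_derive1M (Hcst 2) Hy)))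
    (is_derive1M (Hcst K) (is_derive1M Hy Hy)))
    (is_derive1M (is_derive1B (Hcst N%:R) Hb) Hy).
  by apply: is_derive_eq H _; rewrite /v1 /b1 /=; ring.
have Hy1 := is_derive1_div (g := id) cN0 Hnum (is_derive_id c 1).
have Hy2 := is_derive1_pos_ext c0 (fun x x0 => esym (derive1_painleve_fun x0)) Hy1.
split; first by split; [case: Hy | case: Hy2].
rewrite /painleveV derive1E derive1_painleve_fun //.
have [_ ->] := Hy2.
have Hg : is_derive c 1 g (b1 + 1).
  have H := is_derive1B
    (is_derive1D (is_derive1D Hb (is_derive_id c (1 : R)))
      (is_derive_cst K c (1 : R)))
    (is_derive_cst (n%:R : R) c (1 : R)).
  by apply: is_derive_eq H _; rewrite addr0 subr0.
(* Differentiating [cauchy_eq] gives a second expression of [v'], to be compared with the Riccati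
   equation. *)
have v1E : v1 = - (b1 + 1) * y c - g c * y1 c.
  have H := is_derive1D
    (is_derive1B (is_derive1B (is_derive_cst (alpha - 1) c (1 : R)) Hb) (is_derive_id c (1 : R)))
    (is_derive1M Hg (is_derive1B (is_derive_cst (1 : R) c (1 : R)) Hy)).
  have -> : v1 = _ := is_derive1_pos_eq c0 cauchy_eq Hv H.
  by rewrite -/b1 /=; ring.
(* This turns the quotient-rule form of [y''] into the expression of [c * y2 + y1] required by
   [pv_algebra]. *)
have quot_rule (A B : R) : c * ((A * c - B * 1) / c ^+ 2) + B / c = A by field.
apply: (@pv_algebra _ N%:R n%:R alpha c (y c) (b c) (v c) (bt c) (bt1 c) _ _ v1 b1) => //.
- by rewrite gt_eqF // painleve_fun_gt0.
- by rewrite subr_eq0 lt_eqF // painleve_fun_lt1.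
- exact: endpoint_eq.
- exact: cauchy_eq.
- by rewrite mulrC divfK.
- by rewrite mulrC divfK.
- by rewrite mulrC divfK.
Qed.

(** Once [bt], [v] and [y'] are expressed through [b] and [y], both formulas are rational identities
    in which [b] and [y] are free. *)
Lemma painleve_fun_xy c : 0 < c ->
  (bt c / c + n%:R) / N%:R =
    xnum N n alpha c (y c) (derive1 y c) / xden N c (y c) /\
  - ((b c + N%:R + 1 + c - n%:R - alpha) / N%:R) =
    ynum N n alpha c (y c) (derive1 y c) / yden N (y c).
Proof.
move=> c0; rewrite derive1_painleve_fun //.
have cN0 : c != 0 by rewrite gt_eqF.
have y0 : y c != 0 by rewrite gt_eqF // painleve_fun_gt0.
have y10 : y c - 1 != 0 by rewrite subr_eq0 lt_eqF // painleve_fun_lt1.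
have N0 : N%:R != 0 :> R by rewrite pnatr_eq0 -lt0n (leq_trans _ nN).
have -> : bt c = g c * (N%:R - b c - (K * y c + v c)) - c * n%:R.
  by rewrite endpoint_eq // addrC addKr.
rewrite /xnum /xden /ynum /yden /y1 cauchy_eq // /g /K.
move: (y c) (b c) y0 y10 => z b0 z0 z10.
by split; field; rewrite ?z0 ?z10 ?cN0 ?N0.
Qed.

End PainleveFunction.

(** * The generalized Krawtchouk weight *)

Section KrawtchoukWeight.
Variables (R : realType) (N : nat) (alpha : R).
Hypothesis alpha_lt1 : alpha < 1.
Local Notation w := (krawtchouk_weight N alpha).

Let pochhammer_gt0 k : 0 < pochhammer (1 - alpha) k.
Proof. by apply: prodr_gt0 => j _; rewrite ltr_wpDr ?ler0n // subr_gt0. Qed.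

Lemma krawtchouk_weight_gt0 (c : R) : 0 < c ->
  forall k, (k <= N)%N -> 0 < w c k.
Proof.
by move=> c0 k kN; rewrite mulr_gt0 ?ltr0n ?bin_gt0 // divr_gt0 ?exprn_gt0.
Qed.

Lemma krawtchouk_weight_derive (c : R) k : 0 < c -> (k <= N)%N ->
  is_derive c 1 (fun x => w x k) (k%:R * w c k / c).
Proof.
move=> c0 kN; have cN0 : c != 0 by rewrite gt_eqF.
have p0 : pochhammer (1 - alpha) k != 0 by rewrite gt_eqF.
have HX : is_derive c 1 (fun x : R => x ^+ k) (k%:R * c ^+ k / c).
  apply: DeriveDef; first exact: exprn_derivable.
  rewrite -derive1E exp_derive1. transitivity (k%:R * c ^+ k.-1); first by [].
  by case: k {kN p0} => [|k]; [rewrite !mul0r | rewrite exprS; field].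
have H := is_derive1M (is_derive_cst ('C(N, k)%:R : R) c (1 : R))
  (is_derive1M HX (is_derive_cst ((pochhammer (1 - alpha) k)^-1) c (1 : R))).
by apply: is_derive_eq H _; rewrite /krawtchouk_weight !mulr0 addr0 add0r /=; field; rewrite cN0 p0.
Qed.

Lemma krawtchouk_weight_ratio (c : R) : 0 < c -> forall k, (k < N)%N ->
  k.+1%:R * (k.+1%:R - alpha) * w c k.+1 = c * (N%:R - k%:R) * w c k.
Proof.
move=> c0 k kN; have p0 : pochhammer (1 - alpha) k != 0 by rewrite gt_eqF.
have q0 : 1 - alpha + k%:R != 0.
  by rewrite gt_eqF // ltr_wpDr ?ler0n // subr_gt0.
have binE : k.+1%:R * 'C(N, k.+1)%:R = (N%:R - k%:R) * 'C(N, k)%:R :> R.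
  by rewrite -natrB ?(ltnW kN) // -!natrM mul_bin_left.
have pE : pochhammer (1 - alpha) k.+1 = pochhammer (1 - alpha) k * (1 - alpha + k%:R).
  by rewrite /pochhammer big_ord_recr.
rewrite /krawtchouk_weight pE exprS.
transitivity (k.+1%:R * 'C(N, k.+1)%:R * (c * c ^+ k / pochhammer (1 - alpha) k)).
  by rewrite -natr1; field; rewrite p0 q0.
by rewrite binE; ring.
Qed.

End KrawtchoukWeight.

(** * From orthonormal to monic polynomials *)

Section Normalization.
Variables (R : realType) (N : nat) (w : nat -> R) (p : nat -> {poly R}).
Hypothesis p_orth : orthonormal_polys N w p.

Definition monic_scale (q : {poly R}) : {poly R} := (lead_coef q)^-1 *: q.
Local Notation P := (fun n => monic_scale (p n)).

Let lead_gt0 n : (n <= N)%N -> 0 < lead_coef (p n).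
Proof. by move=> nN; have [/(_ n nN)[]] := p_orth. Qed.

Let node_sum_scale m n : (m <= N)%N -> (n <= N)%N ->
  node_sum N w (P m * P n) =
  (lead_coef (p m))^-1 * (lead_coef (p n))^-1 * (m == n)%:R.
Proof.
move=> mN nN; rewrite /monic_scale -scalerAl -scalerAr !node_sumZ mulrA.
congr (_ * _); rewrite -p_orth.2 //; apply: eq_bigr => k _; by rewrite hornerM.
Qed.

Lemma monic_scale_orthogonal : monic_orthogonal N w P.
Proof.
split=> [n nN | m n mN nN mn]; last by rewrite node_sum_scale // (negPf mn) mulr0.
have l0 : lead_coef (p n) != 0 by rewrite gt_eqF ?lead_gt0.
rewrite size_scale ?invr_eq0 // monicE lead_coefZ mulVf //.
by have [/(_ n nN)[]] := p_orth.
Qed.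

Let sqnormE n : (n <= N)%N -> sqnorm N w P n = (lead_coef (p n)) ^- 2.
Proof. by move=> nN; rewrite /sqnorm node_sum_scale // eqxx mulr1 -expr2 exprVn. Qed.

Let scale_mulX (d e : R) (q r : {poly R}) :
  (d *: q) * ('X * (e *: r)) = (d * e) *: (q * ('X * r)).
Proof. by rewrite -scalerAl -!scalerAr scalerA. Qed.

Lemma rec_bE n : (n <= N)%N -> rec_b N w p n = diag_coef N w P n.
Proof.
move=> nN; have l0 : lead_coef (p n) != 0 by rewrite gt_eqF ?lead_gt0.
rewrite /diag_coef sqnormE // invrK.
rewrite /monic_scale scale_mulX node_sumZ.
rewrite (_ : rec_b N w p n = node_sum N w (p n * ('X * p n))).
  by field.
by apply: eq_bigr => k _; rewrite !hornerM hornerX; ring.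
Qed.

Lemma sqr_rec_aE n : (forall k, (k <= N)%N -> 0 < w k) -> (n <= N)%N ->
  rec_a N w p n ^+ 2 = sub_coef N w P n.
Proof.
move=> w_gt0; case: n => [|n] nN; first by rewrite expr0n.
have l0 : lead_coef (p n) != 0 by rewrite gt_eqF ?lead_gt0 // ltnW.
have l1 : lead_coef (p n.+1) != 0 by rewrite gt_eqF ?lead_gt0.
have := node_sumXPP monic_scale_orthogonal nN.
rewrite /sub_coef !sqnormE // ?(ltnW nN) //.
rewrite /monic_scale scale_mulX node_sumZ.
rewrite (_ : node_sum N w _ = rec_a N w p n.+1) => [E|]; last first.
  by apply: eq_bigr => k _; rewrite !hornerM hornerX; ring.
(* [node_sumXPP], rescaled, determines [a_{n+1}] as the ratio of consecutive leading
   coefficients. *)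
have -> : rec_a N w p n.+1 = lead_coef (p n) / lead_coef (p n.+1).
  apply: (mulfI (_ : (lead_coef (p n.+1))^-1 * (lead_coef (p n))^-1 != 0)).
    by rewrite mulf_neq0 ?invr_eq0.
  by rewrite E; field; rewrite l0 l1.
by field; rewrite l0 l1.
Qed.

End Normalization.

(* The quotient formulas determine y, and for n = N they would force y = 0;
   so the top index is stated with the denominators multiplied out. *)
Theorem theorem1p2 (R : realType) (N : nat) (alpha : R)
    (p : R -> nat -> {poly R})
    (hN : (1 <= N)%N) (halpha : alpha < 1)
    (hp : forall c : R, 0 < c ->
            orthonormal_polys N (krawtchouk_weight N alpha c) (p c))
    (n : nat) (hn : (n <= N)%N) :
  let A : R := (alpha - N%:R - 1) ^+ 2 / 2 in
  let B : R := - ((n%:R - N%:R) ^+ 2 / 2) in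
  let C : R := - (n%:R + alpha) in
  let D : R := - (1 / 2) in
  exists y : R -> R,
    [/\ forall c : R, 0 < c -> twice_derivable y c,
        (n < N)%N -> forall c : R, 0 < c ->
          [/\ y c != 0 /\ y c != 1,
              painleveV A B C D y c,
              xseq N alpha p n c =
                xnum N n alpha c (y c) (derive1 y c) / xden N c (y c) &
              yseq N alpha p n c =
                ynum N n alpha c (y c) (derive1 y c) / yden N (y c)] &
        n = N -> forall c : R, 0 < c ->
          [/\ painleveV_cleared A B C D y c,
              xden N c (y c) * xseq N alpha p n c =
                xnum N n alpha c (y c) (derive1 y c) &
              yden N (y c) * yseq N alpha p n c =
                ynum N n alpha c (y c) (derive1 y c)]].
Proof.
move=> A B C D; have [nN|nN] := ltnP n N; last first.
  have nE : n = N by apply/eqP; rewrite eqn_leq hn.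
  (* At [n = N] the parameter [B] is 0, and all of [xnum], [xden], [ynum], [yden] vanish at
     [y = y' = 0]. *)
  pose z : R -> R := fun=> 0.
  have zE c : z c = 0 by [].
  have dz c : derive1 z c = (0 : R) by rewrite derive1_cst.
  have dzE : derive1 z = z by apply/funext.
  exists z; split=> // [c c0|_ c c0].
    by rewrite /twice_derivable dzE; split; exact: derivable_cst.
  rewrite /painleveV_cleared dzE dz /xden /xnum /yden /ynum /B nE subrr.
  by rewrite zE; split; ring.
pose W c := krawtchouk_weight N alpha c.
pose P c j := monic_scale (p c j).
have W_gt0 := krawtchouk_weight_gt0 halpha.
have P_orth c (c0 : 0 < c) := monic_scale_orthogonal (hp c c0).
have W_derive := krawtchouk_weight_derive halpha.
have W_ratio := krawtchouk_weight_ratio halpha.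
exists (painleve_fun N n alpha W P); split=> [c c0|_ c c0|nNE]; last by rewrite nNE ltnn in nN.
  exact: (painleve_fun_ode (W_gt0 N) (W_derive N) (W_ratio N) P_orth halpha nN c0).1.
have [_ pV] := painleve_fun_ode (W_gt0 N) (W_derive N) (W_ratio N) P_orth halpha nN c0.
have [xE yE] := painleve_fun_xy (W_gt0 N) (W_derive N) (W_ratio N) P_orth halpha nN c0.
have y0 := painleve_fun_gt0 (W_gt0 N) P_orth halpha nN c0.
have y1 := painleve_fun_lt1 (W_gt0 N) (W_ratio N) P_orth halpha nN c0.
split => //; first by rewrite gt_eqF ?lt_eqF.
  by rewrite /xseq (sqr_rec_aE (hp c c0) (W_gt0 N c c0) (ltnW nN)) mul1r mulrC.
by rewrite /yseq (rec_bE (hp c c0)) // ltnW.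
Qed.
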